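(* Let $n$ be a Carmichael number. If any of the following groups exists, then there is no integer $k\geq 2$ with $k\varphi(n)=n-1$: (i) a noncyclic group $G$ of order $2n$ with $\psi''(G)>\frac{13}{42}$; (ii) a noncyclic group $G$ of order $4n$ with $\psi''(G)>\frac{7}{24}$; (iii) a noncyclic group $G$ of order $8n$ with $\psi''(G)>\frac{9}{32}$; (iv) for some integer $\alpha\geq 4$, a noncyclic group $G$ of order $2^{\alpha}n$ with $$\psi''(G)>\frac{16}{63}+\frac{1}{9\cdot 2^{2\alpha-1}}.$$
   Context: A composite positive integer $n$ is a Carmichael number if $b^n\equiv b\pmod n$ for every integer $b$ (equivalently, $n$ is squarefree and $(p-1)\mid(n-1)$ for every prime $p\mid n$). For a finite group $G$, $\psi(G):=\sum_{x\in G}\operatorname{ord}(x)$ and $\psi''(G):=\psi(G)/|G|^2$. $\varphi$ is Euler's totient function. *)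

(* Defs.v *)
From HB Require Import structures.
From mathcomp Require Import all_boot all_order all_algebra all_fingroup all_solvable.

Set Implicit Arguments.
Unset Strict Implicit.
Unset Printing Implicit Defensive.

Import Order.TTheory GRing.Theory Num.Theory.
Local Open Scope ring_scope.

Definition composite (n : nat) : bool := (1 < n)%N && ~~ prime n.

Definition carmichael (n : nat) : Prop :=
  composite n /\ forall b : int, (b ^+ n = b %[mod n%:Z])%Z.

Definition psi (gT : finGroupType) (G : {group gT}) : nat :=
  (\sum_(x in G) #[x]%g)%N.

Definition psi'' (gT : finGroupType) (G : {group gT}) : rat :=
  (psi G)%:R / #|G|%:R ^+ 2.

(* Main.v *)
Require Import Defs.
From mathcomp Require Import all_boot all_order all_algebra all_fingroup all_solvable.
From mathcomp Require Import classfun zify ring lra.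

Import Order.TTheory GRing.Theory Num.Theory.
Local Open Scope ring_scope.

(* If [k * phi(n) = n - 1] with [k >= 2], then [n] is prime to [phi(n)], hence
   squarefree, and [phi(n) / n <= 1/2]. For a cyclic group [N] of order [n] this gives
   [psi''(N) = phi(n)/n * prod_(p | n) (1 + 1/(p(p-1))) <= 1/2 * 4/3 = 2/3], the product
   over odd primes being below [4/3].
   Each hypothesis on [G] forces [psi''(G) > 1/4], so [G] has a cyclic subgroup of index
   less than 4, and then one [C] of index exactly 2 (in index 3, use that a Sylow
   3-subgroup centralises every cyclic subgroup it normalises, as 3 does not divide
   [phi(n)]). Let [N] be the odd part of [C], [A] its subgroup centralised by [G] and
   [b = |N : A|]. The 2'-parts of the elements outside [C] lie in [A], so these elements
   contribute at most [psi''(A) / 2b <= 3/14 * psi''(N)] to [psi''(G)] if [b > 1]. If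
   [b = 1] the 2-elements of the noncyclic group [G] are not of maximal order, which bounds
   the contribution by [psi''(N) / 4], and by [3/16 * psi''(N)] when [16 %| #|G|]. *)

Section LehmerGroups.

Set Implicit Arguments.
Unset Strict Implicit.

Local Open Scope group_scope.
Local Open Scope nat_scope.

(** * An Euler-type product over odd primes *)

(** With denominators cleared, the terms of degree 4, 3 and 2 in [r] agree on both sides, and the
    right side exceeds the left by [4 * r + 6]. *)
Lemma telescope_factor (r : rat) : (1 <= r)%R ->
  ((4 * r - 2) / (4 * r - 1) * (1 + ((2 * r + 1) * (2 * r))^-1)
    <= (4 * (r + 1) - 2) / (4 * (r + 1) - 1))%R.
Proof.
move=> r_ge1.
have -> : ((4 * r - 2) / (4 * r - 1) * (1 + ((2 * r + 1) * (2 * r))^-1) =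
  ((4 * r - 2) * (4 * r ^+ 2 + 2 * r + 1)) / ((4 * r - 1) * (4 * r ^+ 2 + 2 * r)))%R.
  by field; repeat (apply/andP; split); apply: lt0r_neq0; nra.
rewrite ler_pdivrMr; last by apply: mulr_gt0; nra.
rewrite mulrAC ler_pdivlMr; last by lra.
nra.
Qed.

(* Telescoping: with [h i = (4i-2)/(4i-1)], the factor of [p = 2i+1] is at most
   [h (i+1) / h i]; the starting point [i = 5] must be checked with [9] left out. *)
Lemma prod_odd_primes_bound (S : {pred nat}) (i : nat) :
    (forall p, p \in S -> prime p && odd p) -> 5 <= i ->
  (\prod_(0 <= p < i.*2.+1 | p \in S) (1 + (p * p.-1)%:R^-1)
    <= 4 / 3 * ((4 * i%:R - 2) / (4 * i%:R - 1)) :> rat)%R.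
Proof.
move=> S_odd_prime; rewrite big_mkcond /=.
elim: i => [lt4i|i IHi]; first by case: (notF lt4i).
have if_le p (c : rat) : (1 <= c -> 0 <= (if p \in S then c else 1) <= c)%R.
  by case: ifP => _ c_ge1; lra.
have notS p : ~~ (prime p && odd p) -> (p \in S) = false.
  by move=> not_pr; apply/negbTE; apply: contra not_pr => /S_odd_prime.
rewrite leq_eqVlt => /predU1P[<- | lt4i].
  have -> F : (\prod_(0 <= p < 5.*2.+1) F p =
      F 0 * F 1 * F 2 * F 3 * F 4 * F 5 * F 6 * F 7 * F 8 * F 9 * F 10 :> rat)%R.
    by rewrite !big_nat_recr // big_geq //= mul1r.
  rewrite (notS 0 isT) (notS 1 isT) (notS 2 isT) (notS 4 isT).
  rewrite (notS 6 isT) (notS 8 isT) (notS 9 isT) (notS 10 isT).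
  have /andP[] := if_le 3 (1 + (3 * 2)%:R^-1)%R ltac:(lra).
  have /andP[] := if_le 5 (1 + (5 * 4)%:R^-1)%R ltac:(lra).
  have /andP[] := if_le 7 (1 + (7 * 6)%:R^-1)%R ltac:(lra).
  rewrite [3.-1]/= [5.-1]/= [7.-1]/=.
  move: (if 3 \in S then _ else _) (if 5 \in S then _ else _) (if 7 \in S then _ else _).
  move=> c3 c5 c7 c7_ge0 c7_le c5_ge0 c5_le c3_ge0 c3_le.
  rewrite !mul1r !mulr1.
  apply: le_trans (ler_pM _ c7_ge0 (ler_pM c3_ge0 c5_ge0 c3_le c5_le) c7_le) _.
    exact: mulr_ge0.
  (* The extreme case has 3, 5 and 7 all in [S]: 7/6 * 21/20 * 43/42 = 301/240. The claimed bound at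
     [i = 5] is 4/3 * 18/19 = 24/19. *)
  rewrite [leLHS](_ : _ = 301 / 240)%R; last by field.
  by rewrite [leRHS](_ : _ = 24 / 19)%R; [lra | field].
rewrite doubleS big_nat_recr; last by [].
rewrite big_nat_recr; last by [].
rewrite (notS i.*2.+2); last by rewrite /= odd_double andbF.
have i_ge5 : (5 <= i%:R :> rat)%R by rewrite ler_nat.
have den_gt0 : (0 < (i.*2.+1 * i.*2)%:R :> rat)%R by rewrite ltr0n; lia.
have c_ge1 : (1 <= 1 + (i.*2.+1 * i.*2)%:R^-1 :> rat)%R by rewrite lerDl invr_ge0 ltW.
have /andP[c_ge0 c_le] := if_le i.*2.+1 _ c_ge1.
apply: (@le_trans _ _ ((4 / 3 * ((4 * i%:R - 2) / (4 * i%:R - 1)))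
                       * (1 + (i.*2.+1 * i.*2)%:R^-1))%R).
  rewrite /= mulr1; apply: ler_pM => //; last exact: IHi.
  by apply: prodr_ge0 => p _; case: ifP => // _; rewrite addr_ge0 // invr_ge0 ler0n.
rewrite -mulrA ler_pM2l; last by lra.
have -> : (i.*2.+1 * i.*2)%:R = ((2 * i%:R + 1) * (2 * i%:R) :> rat)%R.
  by rewrite natrM -[i.*2.+1]addn1 natrD -mul2n natrM.
rewrite -[i.+1]addn1 natrD; apply: telescope_factor; lra.
Qed.

(** * Sums of element orders in direct products and cyclic groups *)

Lemma psi_dprod (gT : finGroupType) (K H G : {group gT}) :
  (K \x H)%g = G -> coprime #|K| #|H| -> psi G = psi K * psi H.
Proof.
move=> defG coKH; rewrite /psi (reindex_dprod defG) big_distrl.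
apply: eq_bigr => x Kx; rewrite big_distrr; apply: eq_bigr => y Hy /=.
have [_ _ cKH _] := dprodP defG.
apply: orderM; first by apply: (centsP _ _ Kx _ Hy); rewrite centsC.
exact: coprime_dvdl (order_dvdG Kx) (coprime_dvdr (order_dvdG Hy) coKH).
Qed.

(** Nontrivial elements have order at least 3, so [psi H >= 3 * #|H| - 2], and [#|H| >= 3]. Order 3
    gives equality. *)
Lemma psi_odd_lower_bound (gT : finGroupType) (H : {group gT}) :
  odd #|H| -> 1 < #|H| -> 7 * #|H| <= 3 * psi H.
Proof.
move=> oddH H_gt1.
have order_ge3 x : x \in H^#%g -> 3 <= #[x]%g.
  rewrite !inE => /andP[ntx Hx].
  have : odd #[x]%g by apply: dvdn_odd (order_dvdG Hx) oddH.
  by have := order_gt1 x; rewrite ntx; case: #[x]%g => [|[|[|]]].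
rewrite /psi (big_setD1 1%g) //= order1.
have: \sum_(x in H^#%g) 3 <= \sum_(x in H^#%g) #[x]%g by apply: leq_sum.
rewrite sum_nat_const; have := cardsD1 1%g H; rewrite group1.
rewrite /= add1n => oH; move: oddH H_gt1; rewrite oH.
by move: #|_| (\sum_(x in _) _) => c s; lia.
Qed.

Lemma cyclic_coprime_dprod (gT : finGroupType) (G : {group gT}) (a b : nat) :
    cyclic G -> #|G| = a * b -> coprime a b ->
  exists K H : {group gT},
    [/\ (K \x H)%g = G, #|K| = a & #|H| = b].
Proof.
case/cyclicP=> x defG; rewrite defG => oab coab; have := oab; rewrite -orderE => ox.
have ab_gt0 : 0 < a * b by rewrite -ox.
exists <[(x ^+ b)%g]>%G, <[(x ^+ a)%g]>%G.
have oa : #[(x ^+ b)%g]%g = a.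
  by rewrite orderXdiv ox ?dvdn_mull // mulnK //; lia.
have ob : #[(x ^+ a)%g]%g = b.
  by rewrite orderXdiv ox ?dvdn_mulr // mulKn //; lia.
split=> //; apply/eqP; rewrite /= dprodE //; last 2 first.
- by apply: (sub_abelian_cent2 (cycle_abelian x)); apply: cycleX.
- by apply: coprime_TIg; rewrite -!orderE oa ob.
rewrite eqEcard mul_subG ?cycle_subG ?groupX ?cycle_id //=.
by rewrite coprime_cardMg -!orderE ?oa ?ob ?ox.
Qed.

(** Half of [H] lies outside the subgroup of squares and contributes at most [#|H|] per element; the
    squares are handled by induction. *)
Lemma psi_cyclic_2group (gT : finGroupType) (H : {group gT}) (k : nat) :
  cyclic H -> #|H| = 2 ^ k -> 3 * psi H <= 2 * 4 ^ k + 1.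
Proof.
elim: k H => [|k IHk] H cycH oH.
  by rewrite /psi (card1_trivg oH) big_set1 order1.
have [x defH] := cyclicP cycH; have ox : #[x]%g = 2 ^ k.+1 by rewrite -oH defH.
have sKH : (<[x ^+ 2]> \subset H)%g by rewrite defH cycleX.
have oK : #|<[(x ^+ 2)%g]>%g| = 2 ^ k.
  by rewrite -orderE orderXdiv ox expnS ?dvdn_mulr // mulKn.
have := IHk <[(x ^+ 2)%g]>%G (cycle_cyclic _) oK.
have -> : psi H = psi <[(x ^+ 2)%g]>%G + \sum_(y in H :\: <[(x ^+ 2)%g]>%g) #[y]%g.
  by rewrite /psi (big_setID <[(x ^+ 2)%g]>%g) /= (setIidPr sKH).
have : \sum_(y in H :\: <[(x ^+ 2)%g]>%g) #[y]%g <= 2 ^ k * 2 ^ k.+1.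
  have <- : #|H :\: <[(x ^+ 2)%g]>%g| = 2 ^ k.
    by rewrite cardsD (setIidPr sKH) oH oK expnS; lia.
  rewrite -sum_nat_const leq_sum // => y /setDP[Hy _].
  by rewrite -oH dvdn_leq ?order_dvdG.
have pow4 m : 4 ^ m = 2 ^ m * 2 ^ m by rewrite -[4]/(2 * 2) expnMn.
rewrite !pow4 !expnS; move: (2 ^ k) (\sum_(y in _) _) (psi _) => u s t; nia.
Qed.

(** A group of prime order [p] has [psi] equal to [p * p.-1 + 1]. Primes are split off one at a time
    by multiplicativity. *)
Lemma psi_squarefree (gT : finGroupType) (G : {group gT}) (s : seq nat) :
    cyclic G -> uniq s -> all prime s -> #|G| = \prod_(p <- s) p ->
  psi G <= \prod_(p <- s) (p * p.-1 + 1).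
Proof.
elim: s G => [|p s IHs] G cycG /=.
  rewrite !big_nil => _ _ oG.
  by rewrite /psi (card1_trivg oG) big_set1 order1.
case/andP=> s'p uniq_s /andP[p_pr s_pr]; rewrite !big_cons => oG.
have co_p : coprime p (\prod_(q <- s) q).
  rewrite big_seq; apply: (big_ind (coprime p)) => [|a b|q sq]; first exact: coprimen1.
    by rewrite coprimeMr => -> ->.
  rewrite prime_coprime //; apply: contra s'p.
  by rewrite (dvdn_prime2 p_pr (allP s_pr q sq)) => /eqP->.
have [K [H [defG oK oH]]] := cyclic_coprime_dprod cycG oG co_p.
have cycH : cyclic H by apply: cyclicS cycG; have /dprodP[_ <- _ _] := defG; apply: mulG_subr.
rewrite (psi_dprod defG) ?oK ?oH // leq_mul ?IHs //.
rewrite /psi (big_setD1 1%g) //= order1 addnC leq_add2r.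
have -> : p * p.-1 = \sum_(x in K^#%g) p.
  by rewrite sum_nat_const mulnC; have := cardsD1 1%g K; rewrite group1 oK => ->.
by rewrite leq_sum // => x /setD1P[_ Kx]; rewrite -oK dvdn_leq ?order_dvdG.
Qed.

(** * Totients and squarefree orders *)

Lemma totient_dvd (d m : nat) : 0 < m -> d %| m -> totient d %| totient m.
Proof.
move=> m_gt0 dv_dm; have d_gt0 := dvdn_gt0 m_gt0 dv_dm.
rewrite !totientE //.
have -> : primes d = [seq p <- primes m | p \in primes d].
  apply: (irr_sorted_eq ltn_trans ltnn (sorted_primes d)).
    exact: sorted_filter ltn_trans _ _ (sorted_primes m).
  move=> p; rewrite mem_filter; case: (boolP (p \in primes d)) => //= dp.
  move: dp; rewrite !mem_primes m_gt0 d_gt0 => /and3P[-> _ dp].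
  by rewrite (dvdn_trans dp).
rewrite big_filter big_mkcond /=.
apply: (big_ind2 dvdn) => // [a b c e|p _]; first exact: dvdn_mul.
case: ifP => // _; rewrite dvdn_mul // dvdn_exp2l // -!subn1 leq_sub2r //.
exact: dvdn_leq_log.
Qed.

(** A repeated prime factor of [n] would also divide [totient n]. *)
Lemma logn_coprime_totient (n p : nat) :
  coprime n (totient n) -> p \in primes n -> logn p n = 1.
Proof.
move=> co_n n_p; have := n_p; rewrite mem_primes => /and3P[p_pr n_gt0 p_dv_n].
have := n_p; rewrite -logn_gt0; case e: (logn p n) => [|[|k]] // _.
have p_dv_phi : p %| totient n.
  by rewrite totientE // (big_rem p) //= e /= expnS dvdn_mulr // dvdn_mull // dvdn_mulr.
have : p %| gcdn n (totient n) by rewrite dvdn_gcd p_dv_n.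
by rewrite (eqP co_n) dvdn1 => /eqP p1; rewrite p1 in p_pr.
Qed.

Lemma prod_primes_coprime_totient (n : nat) :
  0 < n -> coprime n (totient n) -> n = \prod_(p <- primes n) p.
Proof.
move=> n_gt0 co_n; rewrite {1}(prod_prime_decomp n_gt0) prime_decompE big_map.
apply: eq_big_seq => p n_p.
by rewrite /= (logn_coprime_totient co_n n_p) expn1.
Qed.

(** A common prime of [a] and [b] would have exponent at least 2 in [a * b]. *)
Lemma coprime_factors_coprime_totient (a b : nat) :
  0 < a * b -> coprime (a * b) (totient (a * b)) -> coprime a b.
Proof.
move=> ab_gt0 co_ab; apply: contraT => nco.
have [a_gt0 b_gt0] : 0 < a /\ 0 < b by apply/andP; rewrite -muln_gt0.
have g_gt1 : 1 < gcdn a b by rewrite ltn_neqAle eq_sym nco gcdn_gt0 a_gt0.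
have := dvdn_trans (pdiv_dvd (gcdn a b)) (dvdn_gcdl a b).
have := dvdn_trans (pdiv_dvd (gcdn a b)) (dvdn_gcdr a b).
have := pdiv_prime g_gt1; move: (pdiv _) => p p_pr pb pa.
have : p \in primes (a * b) by rewrite mem_primes p_pr ab_gt0 dvdn_mulr.
move/(logn_coprime_totient co_ab); rewrite lognM //.
have : 0 < logn p a by rewrite logn_gt0 mem_primes p_pr a_gt0.
have : 0 < logn p b by rewrite logn_gt0 mem_primes p_pr b_gt0.
by lia.
Qed.

(** The order is squarefree, so [#|N| * totient #|N|] is the product of [p * p.-1] over its primes.
    Dividing [psi N] by it leaves at most the product of the [1 + (p * p.-1)^-1], which is at most
    4/3. *)
Lemma psi_cyclic_totient (gT : finGroupType) (N : {group gT}) :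
    cyclic N -> odd #|N| -> coprime #|N| (totient #|N|) ->
  3 * psi N <= 4 * (#|N| * totient #|N|).
Proof.
move=> cycN oddN co_n; have n_gt0 := cardG_gt0 N.
have n_prod := prod_primes_coprime_totient n_gt0 co_n.
have le_psi := psi_squarefree cycN (primes_uniq _) (all_prime_primes _) n_prod.
have phi_prod : totient #|N| = \prod_(p <- primes #|N|) p.-1.
  rewrite totientE //; apply: eq_big_seq => p n_p.
  by rewrite (logn_coprime_totient co_n n_p) muln1.
have primes_odd p : p \in primes #|N| -> prime p && odd p.
  by rewrite mem_primes => /and3P[-> _ /dvdn_odd->].
(* Large enough for the range below [m.*2.+1] to contain every prime divisor of [#|N|], and at least
   5 as the product bound demands. *)
pose m := maxn 5 #|N|.
have := @prod_odd_primes_bound (mem (primes #|N|)) m primes_odd (leq_maxl _ _).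
have -> : (\prod_(0 <= p < m.*2.+1 | p \in primes #|N|) (1 + (p * p.-1)%:R^-1) =
           \prod_(p <- primes #|N|) (1 + (p * p.-1)%:R^-1) :> rat)%R.
  rewrite -big_filter; apply: perm_big; apply: uniq_perm; rewrite ?primes_uniq //.
    by rewrite filter_uniq ?iota_uniq.
  move=> p; rewrite mem_filter mem_index_iota; case: (boolP (p \in primes _)) => //= n_p.
  have : p <= #|N| by move: n_p; rewrite mem_primes => /and3P[_ _ /dvdn_leq->].
  by have := leq_maxr 5 #|N|; rewrite -/m -addnn; lia.
move=> bound.
have {bound} : (\prod_(p <- primes #|N|) (1 + (p * p.-1)%:R^-1) <= 4 / 3 :> rat)%R.
  apply: le_trans bound _; have : (1 <= m%:R :> rat)%R by rewrite ler1n leq_max.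
  move: m%:R%R => r r_ge1; rewrite ler_piMr; [by [] | by lra |].
  by rewrite ler_pdivrMr; lra.
have -> : (\prod_(p <- primes #|N|) (1 + (p * p.-1)%:R^-1) =
   (\prod_(p <- primes #|N|) (p * p.-1 + 1))%:R / (#|N| * totient #|N|)%:R :> rat)%R.
  rewrite phi_prod {3}n_prod -big_split /= !natr_prod -prodf_div.
  apply: eq_big_seq => p /primes_odd/andP[/prime_gt1 p_gt1 _].
  rewrite natrD mulrDl divff ?mul1r ?div1r // pnatr_eq0; lia.
rewrite ler_pdivrMr ?ltr0n ?muln_gt0 ?n_gt0 ?totient_gt0 //.
rewrite mulrAC ler_pdivlMr // -!natrM ler_nat => le_prod.
by apply: leq_trans le_prod; rewrite mulnC leq_mul2r le_psi.
Qed.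

(** * From a cyclic subgroup of index 3 to one of index 2 *)

(** Some [K] of index at most 2 in [C] is normal in [G]. A Sylow 3-subgroup [P] has order 3 and
    centralises [K], so [K <*> P] is cyclic of order [3 * #|K|]. If [K = C] this is all of [G],
    which is excluded; otherwise it has index 2. *)
Lemma index3_index2 (gT : finGroupType) (G C : {group gT}) :
    cyclic C -> C \subset G -> #|G : C|%g = 3 -> ~~ cyclic G ->
    coprime 3 #|C| -> coprime 3 (totient #|C|) ->
  exists2 D : {group gT}, cyclic D & D \subset G /\ #|G : D|%g = 2.
Proof.
move=> cycC sCG iC ncycG co3C co3phi.
have oG : #|G| = 3 * #|C| by rewrite -(Lagrange sCG) iC mulnC.
have C_gt0 := cardG_gt0 C.
have [K [nKG sKC oK]] : exists K : {group gT},
    [/\ G \subset 'N(K)%g, K \subset C & #|C| = #|K| \/ #|C| = 2 * #|K|].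
  have [nCG | ] := boolP (G \subset 'N(C)%g); first by exists C; split=> //; left.
  case/subsetPn=> g Gg; rewrite inE => /negP not_nCg.
  have oCg : #|(C :^ g)%g| = #|C| by apply: cardJg.
  have sCgG : (C :^ g)%g \subset G by rewrite -(conjGid Gg) conjSg.
  (* The product set [C * C :^ g] has [#|C| * #|C : K|] elements, at most [#|G| = 3 * #|C|]. Index 1
     would make [g] normalise [C], and index 3 is impossible since 3 does not divide [#|C|]. *)
  pose K := (C :&: C :^ g)%G.
  have sKC : K \subset C by apply: subsetIl.
  have sKCg : K \subset (C :^ g)%G by apply: subsetIr.
  have lt1 : 1 < #|C : K|%g.
    rewrite indexg_gt1; apply/negP=> sCK; apply: not_nCg.
    have sCCg := subset_trans sCK sKCg.
    have /eqP <- : C :==: (C :^ g)%g by rewrite eqEcard sCCg oCg /=.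
    by [].
  have le3 : #|C : K|%g <= 3.
    have := mul_cardG C (C :^ g); rewrite oCg -/K => eqK.
    have : #|(C * C :^ g)%g| <= #|G| by rewrite subset_leq_card // mul_subG.
    have := Lagrange sKC; rewrite oG; move: eqK (cardG_gt0 K).
    by rewrite /= -/K; move: #|_| #|_| #|_ : _|%g #|_| => c m k i; nia.
  have iK : #|C : K|%g = 2.
    apply/eqP; rewrite eqn_leq lt1 andbT -ltnS ltn_neqAle le3 andbT.
    apply: contraTneq co3C => i3; rewrite prime_coprime // negbK -i3 dvdn_indexg.
    by [].
  have iKg : #|C :^ g : K|%g = 2.
    apply/eqP; rewrite -(eqn_pmul2l (cardG_gt0 K)) Lagrange // oCg -(Lagrange sKC) iK.
    by [].
  exists K; split=> //; last by right; rewrite -(Lagrange sKC) iK mulnC.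
  (* Having index 2, [K] is normal in [C] and in [C :^ g]. These generate [G]: a subgroup properly
     containing [C] has index less than 2, as [#|G : C| = 3]. *)
  have /andP[_ nKC] := index2_normal sKC iK.
  have /andP[_ nKCg] := index2_normal sKCg iKg.
  pose M := (C <*> C :^ g)%G.
  have sMG : M \subset G by rewrite join_subG sCG.
  have sCM : C \subset M by apply: joing_subl.
  suffices <- : M :=: G by rewrite join_subG nKC.
  apply/eqP; rewrite eqEsubset sMG -indexg_eq1.
  have iM : 1 < #|M : C|%g.
    rewrite indexg_gt1 join_subG subxx /=; apply/negP=> sCgC; apply: not_nCg.
    by [].
  rewrite eqn_leq indexg_gt0 andbT -ltnS -(ltn_pmul2r (ltnW iM)).
  by rewrite Lagrange_index // iC; apply: leq_trans (leq_mul (leqnn 2) iM).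
have [P sylP] := Sylow_exists 3 G.
have sPG := pHall_sub sylP.
have oP : #|P| = 3.
  rewrite (card_Hall sylP) oG partnM // part_pnat_id ?pnat_id //.
  by rewrite part_p'nat ?muln1 // p'natE // -prime_coprime.
have coKP : coprime #|K| #|P|.
  by rewrite oP coprime_sym; apply: coprime_dvdr (cardSg sKC) co3C.
have cycK := cyclicS sKC cycC.
have cycP : cyclic P by apply: prime_cyclic; rewrite oP.
have nKP := subset_trans sPG nKG.
(* Conjugation maps [P] into [Aut K], of order [totient #|K|]. This divides [totient #|C|], so it is
   prime to 3 and the image is trivial. *)
have cKP : P \subset 'C(K)%g.
  have sAut := cardSg (Aut_conj_aut K P).
  have co3A : coprime 3 #|(conj_aut K @* P)%g|.
    apply: coprime_dvdr co3phi; apply: dvdn_trans sAut _.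
    by rewrite card_Aut_cyclic // totient_dvd ?cardSg.
  rewrite -ker_conj_aut kerE -sub_morphim_pre //.
  have := dvdn_morphim (conj_aut_morphism K) P; rewrite oP => dv3.
  have : coprime #|(conj_aut K @* P)%g| #|(conj_aut K @* P)%g|.
    by apply: coprime_dvdl dv3 _.
  by rewrite /coprime gcdnn -trivg_card1 => /eqP->.
have cycKP : cyclic (K <*> P) by apply: cyclicY.
have oKP : #|(K <*> P)%g| = 3 * #|K|.
  by rewrite (cent_joinEr cKP) coprime_cardMg // oP mulnC.
have sKPG : (K <*> P)%G \subset G by rewrite join_subG sPG (subset_trans sKC).
have iKP := Lagrange sKPG.
case: oK => oK.
  case/negP: ncycG; suffices <- : (K <*> P)%G :=: G by [].
  by apply/eqP; rewrite eqEcard sKPG oG oK /= oKP.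
exists (K <*> P)%G => //; split=> //.
apply/eqP; rewrite -(eqn_pmul2l (cardG_gt0 (K <*> P)%G)) iKP oG oK /= oKP.
by apply/eqP; ring.
Qed.

(** * Elements outside a subgroup of index 2 *)

Lemma index2_sqr (gT : finGroupType) (G C : {group gT}) (g : gT) :
  C \subset G -> #|G : C|%g = 2 -> g \in G -> (g ^+ 2)%g \in C.
Proof.
move=> sCG iC Gg; have /andP[_ nCG] := index2_normal sCG iC.
have nCg := subsetP nCG g Gg; apply: coset_idr; first exact: groupX.
rewrite morphX //; have : coset C g \in (G / C)%g by apply: mem_quotient.
by move/expg_cardG; rewrite card_quotient // iC.
Qed.

(** An element of odd order is a power of its square, which lies in [C]. *)
Lemma index2_odd (gT : finGroupType) (G C : {group gT}) (g : gT) :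
  C \subset G -> #|G : C|%g = 2 -> g \in G -> odd #[g]%g -> g \in C.
Proof.
move=> sCG iC Gg odd_g.
have /eqP eq_cycle : generator <[g]>%g (g ^+ 2)%g by rewrite generator_coprime coprimen2.
by rewrite -cycle_subG eq_cycle cycle_subG (index2_sqr sCG iC).
Qed.

(** [C] and [g] generate [G], and [z] commutes with both. *)
Lemma index2_cent (gT : finGroupType) (G C : {group gT}) (g z : gT) :
    C \subset G -> #|G : C|%g = 2 -> abelian C -> g \in G :\: C ->
  z \in C -> commute z g -> z \in 'C(G)%g.
Proof.
move=> sCG iC abC /setDP[Gg nCg] Cz czg.
suffices <- : (C <*> <[g]>)%G :=: G.
  rewrite centY inE (subsetP abC) //= cent_cycle; exact/cent1P/commute_sym.
have sMG : (C <*> <[g]>)%G \subset G by rewrite join_subG sCG cycle_subG.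
apply/eqP; rewrite eqEsubset sMG -indexg_eq1.
have iM : 1 < #|(C <*> <[g]>)%G : C|%g.
  by rewrite indexg_gt1 join_subG cycle_subG (negPf nCg) andbF.
rewrite eqn_leq indexg_gt0 andbT -ltnS -(ltn_pmul2r (ltnW iM)).
by rewrite Lagrange_index ?joing_subl // iC; apply: leq_trans (leq_mul (leqnn 2) iM).
Qed.

(* Right translation by [A] permutes [G :\: C]; averaging over it replaces the
   [2']-part of each [g] by a uniformly distributed element of [A]. *)
Lemma sum_order_index2 (gT : finGroupType) (G C A : {group gT}) :
    C \subset G -> A \subset C -> A \subset 'C(G)%g -> odd #|A| ->
    (forall g, g \in G :\: C -> g.`_(2^')%g \in A) ->
  #|A| * \sum_(g in G :\: C) #[g]%g = psi A * \sum_(g in G :\: C) #[g.`_2]%g.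
Proof.
move=> sCG sAC cGA oddA partA.
rewrite -sum_nat_const.
transitivity (\sum_(z in A) \sum_(g in G :\: C) #[(g * z)%g]%g).
  apply: eq_bigr => z Az; have Cz := subsetP sAC z Az; have Gz := subsetP sCG z Cz.
  rewrite (reindex_inj (mulIg z)) /=; apply: eq_bigl => g.
  by rewrite !inE !groupMr.
rewrite exchange_big /= big_distrr /=; apply: eq_bigr => g GCg.
have [Gg _] := setDP GCg; have Ag' := partA g GCg.
have cAg y : y \in A -> commute g y.
  by move=> Ay; apply/commute_sym/(centsP cGA).
have order_gz z : z \in A -> #[(g * z)%g]%g = #[g.`_2]%g * #[(g.`_(2^') * z)%g]%g.
  move=> Az; rewrite -{1}(consttC 2 g) -mulgA.
  have Ay : (g.`_(2^') * z)%g \in A by apply: groupM.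
  rewrite orderM //.
    have /cycleP[i ->] := cycle_constt 2 g.
    exact/commute_sym/commuteX/commute_sym/cAg.
  by rewrite order_constt p_part coprimeXl // coprime2n (dvdn_odd (order_dvdG Ay)).
rewrite (eq_bigr _ order_gz) -big_distrr /= mulnC; congr (_ * _).
rewrite /psi [RHS](reindex_inj (mulgI (g.`_(2^'))%g)) /=.
by apply: eq_bigl => z; rewrite groupMl.
Qed.

(** * Orders of 2-parts when the odd part is central *)

(** A 2-part of order [2 ^ a], times a generator of the central subgroup [N], would generate [G]. *)
Lemma noncyclic_order2_bound (gT : finGroupType) (G N : {group gT}) (a n : nat) (g : gT) :
    cyclic N -> N \subset 'C(G)%g -> N \subset G -> #|N| = n -> odd n ->
    #|G| = 2 ^ a * n -> ~~ cyclic G ->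
  g \in G -> #[g.`_2]%g <= 2 ^ a.-1.
Proof.
move=> cycN cGN sNG oN oddn oG ncycG Gg.
have dv : #[g.`_2]%g %| 2 ^ a.
  have : #[g.`_2]%g %| #|G| by rewrite order_dvdG // groupX.
  by rewrite oG Gauss_dvdl // order_constt p_part coprimeXl // coprime2n.
have /(dvdn_pfactor _ _ (isT : prime 2))[k] := dv.
rewrite leq_eqVlt => /predU1P[-> e|ltka ->]; last by rewrite leq_pexp2l // -ltnS; lia.
case/negP: ncycG; have [w defN] := cyclicP cycN.
have Nw : w \in N by rewrite defN cycle_id.
have ogw : #[(g.`_2 * w)%g]%g = 2 ^ a * n.
  have ow : #[w]%g = n by rewrite -oN defN.
  rewrite orderM ?e ?ow ?coprimeXl ?coprime2n //.
  by apply/commute_sym/(centP (subsetP cGN w Nw)); rewrite groupX.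
suffices -> : G :=: <[(g.`_2 * w)%g]>%G by apply: cycle_cyclic.
apply/eqP; rewrite eq_sym eqEcard cycle_subG groupM ?groupX ?(subsetP sNG w Nw) //=.
by rewrite -orderE ogw oG.
Qed.

(* [s^2] and [x^2] generate the same subgroup, which is therefore central, so
   [G] has class at most 2 and [t = s x^-j] with [s^2 = x^2j] satisfies [t^4 = 1]. *)
Lemma index2_two_cyclic (gT : finGroupType) (G C : {group gT}) (x s : gT) (d : nat) :
    C \subset G -> #|G : C|%g = 2 -> C :=: <[x]>%g -> #|C| = 4 * d ->
    s \in G :\: C -> #[s]%g = #|C| ->
  exists t : gT, [/\ t \in G :\: C, (t ^+ 4 = 1)%g
    & {in <[(x ^+ 2)%g]>%g, forall y, commute t y}].
Proof.
move=> sCG iC defC oC GCs os; have [Gs nCs] := setDP GCs.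
have Cx : x \in C by rewrite defC cycle_id.
have ox : #[x]%g = 4 * d by rewrite -oC defC.
have C_gt0 := cardG_gt0 C.
have Cs2 := index2_sqr sCG iC Gs.
have eqD : <[(s ^+ 2)%g]>%g = <[(x ^+ 2)%g]>%g.
  have abxC : cyclic C by rewrite defC cycle_cyclic.
  have sxC : <[(x ^+ 2)%g]>%g \subset C by rewrite cycle_subG groupX.
  have ssC : <[(s ^+ 2)%g]>%g \subset C by rewrite cycle_subG.
  apply/eqP; rewrite (eq_subG_cyclic abxC) // -!orderE.
  by rewrite !orderXdiv ?os ?oC ?ox // -[4]/(2 * 2) -mulnA dvdn_mulr.
have abC : abelian C by rewrite defC cycle_abelian.
have cD y : y \in <[(x ^+ 2)%g]>%g -> y \in 'C(G)%g.
  move=> Dy; apply: (index2_cent sCG iC abC GCs).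
    by apply: subsetP Dy; rewrite cycle_subG groupX.
  move: Dy; rewrite -eqD => /cycleP[i ->].
  by rewrite -expgM; apply/commute_sym/commuteX.
have /cycleP[j def_s2] : (s ^+ 2)%g \in <[(x ^+ 2)%g]>%g by rewrite -eqD cycle_id.
have cz y z : y \in <[(x ^+ 2)%g]>%g -> z \in G -> commute y z.
  by move=> /cD cy Gz; apply: (centP cy).
have Gx := subsetP sCG x Cx.
pose u := (x ^- j)%g; have Gu : u \in G by rewrite groupV groupX.
have nCt : (s * u)%g \notin C by rewrite groupMr // groupV groupX.
exists (s * u)%g; split; last 1 first.
- by move=> y Dy; apply/commute_sym/cz => //; rewrite groupM.
- by rewrite inE nCt groupM.
have /andP[_ nCG] := index2_normal sCG iC.
have Cu : u \in C by rewrite groupV groupX.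
have Cc : [~ u, s]%g \in C.
  by rewrite commgEl; apply: groupM; [rewrite groupV | rewrite memJ_norm ?(subsetP nCG)].
have u2 : (u ^+ 2)%g \in <[(x ^+ 2)%g]>%g.
  by rewrite expVgn -expgM mulnC expgM groupV mem_cycle.
have c2 : ([~ u, s] ^+ 2 = 1)%g.
  rewrite -commXg; last exact: (centsP abC).
  by apply/eqP/commgP; apply: cz.
(* The commutator has order dividing 2, and [<[x ^+ 2]>] has even order [2 * d]; in the cyclic group
   [C] this forces containment. *)
have Dc : [~ u, s]%g \in <[(x ^+ 2)%g]>%g.
  have cycC : cyclic C by rewrite defC cycle_cyclic.
  rewrite -cycle_subG -(cardSg_cyclic cycC) ?cycle_subG ?groupX // -!orderE.
  have ox2 : #[(x ^+ 2)%g]%g = 2 * d.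
    by rewrite orderXdiv ox -[4]/(2 * 2) -mulnA ?mulKn ?dvdn_mulr.
  by rewrite ox2 dvdn_mulr // order_dvdn c2.
have cu : commute u [~ u, s]%g by apply/commute_sym/cz.
have cs : commute s [~ u, s]%g by apply/commute_sym/cz.
(* With a central commutator, [(s * u) ^+ 4] is [s ^+ 4 * u ^+ 4] times the 6th power of [[~ u, s]],
   which vanishes as 6 is even. *)
rewrite expMg_Rmul // (_ : 'C(4, 2) = 2 * 3) // [(_ ^+ (2 * 3))%g]expgM c2 expg1n mulg1.
rewrite -[4]/(2 * 2) expgM def_s2 expVgn -!expgM.
by rewrite mulnCA mulnC mulgV.
Qed.

Lemma expn4 (m : nat) : 4 ^ m = 2 ^ m * 2 ^ m.
Proof. by rewrite -expnMn. Qed.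

(** Every 2-part has order at most [2 ^ a.+3]. If the order [2 ^ a.+3] occurs outside [C], there is
    a second cyclic subgroup of index 2, and on half of [G :\: C] the order is at most [2 ^ a.+2].
    The average is then at most 3/4 of the maximum; otherwise it is at most 1/2. *)
Lemma sum_order2_central (gT : finGroupType) (G C N : {group gT}) (a n : nat) :
    cyclic C -> C \subset G -> #|G : C|%g = 2 -> ~~ cyclic G ->
    #|G| = 2 ^ a.+4 * n -> odd n ->
    cyclic N -> #|N| = n -> N \subset 'C(G)%g -> N \subset C ->
  16 * \sum_(g in G :\: C) #[g.`_2]%g <= 3 * (4 ^ a.+4 * n).
Proof.
move=> cycC sCG iC ncycG oG oddn cycN oN cGN sNC.
have sNG := subset_trans sNC sCG; have n_gt0 : 0 < n by rewrite -oN.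
have oC : #|C| = 2 ^ a.+3 * n.
  apply/eqP; rewrite -(eqn_pmul2r (isT : 0 < 2)) -{1}iC Lagrange // oG expnS; apply/eqP; ring.
have oGC : #|G :\: C| = 2 ^ a.+3 * n.
  by rewrite cardsD (setIidPr sCG) oG oC expnS -mulnA mulSn mul1n addnK.
have le_big g : g \in G -> #[g.`_2]%g <= 2 ^ a.+3.
  exact: (noncyclic_order2_bound cycN cGN sNG oN oddn oG ncycG).
pose Q := 2 ^ a * 2 ^ a * n.
have -> : 3 * (4 ^ a.+4 * n) = 768 * Q by rewrite /Q !expnS expn4; ring.
have [small | ] := boolP [forall g in G :\: C, #[g.`_2]%g <= 2 ^ a.+2].
  have : \sum_(g in G :\: C) #[g.`_2]%g <= #|G :\: C| * 2 ^ a.+2.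
    by rewrite -sum_nat_const leq_sum // => g GCg; have /forall_inP := small; apply.
  have -> : #|G :\: C| * 2 ^ a.+2 = 32 * Q by rewrite /Q oGC !expnS; ring.
  by move: (\sum_(g in _) _) Q; clear => S Q; lia.
rewrite negb_forall_in => /exists_inP[g GCg]; rewrite -ltnNge => lt_g.
have [Gg nCg] := setDP GCg.
have og2 : #[g.`_2]%g = 2 ^ a.+3.
  have := le_big g Gg; rewrite order_constt p_part in lt_g *.
  rewrite ltn_exp2l // in lt_g; rewrite leq_exp2l // => le_g.
  by congr (2 ^ _); apply/eqP; rewrite eqn_leq le_g.
have [x defC] := cyclicP cycC; have [w defN] := cyclicP cycN.
have ow : #[w]%g = n by rewrite -oN defN.
have Nw : w \in N by rewrite defN cycle_id.
pose s := (g.`_2 * w)%g.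
have Gs : s \in G by rewrite groupM ?groupX // (subsetP sNG).
have os : #[s]%g = 2 ^ a.+3 * n.
  rewrite orderM ?og2 ?ow ?coprimeXl ?coprime2n //.
  by apply/commute_sym/(centP (subsetP cGN w Nw)); rewrite groupX.
have nCs : s \notin C.
  rewrite (groupMr _ (subsetP sNC w Nw)); apply: contra nCg => Cg2.
  rewrite -(consttC 2 g) groupM // (index2_odd sCG iC) ?groupX //.
  by rewrite order_constt; have := part_pnat 2^' #[g]%g; rewrite -odd_2'nat.
have oC4 : #|C| = 4 * (2 ^ a.+1 * n) by rewrite oC !expnS; ring.
have [||t [GCt t4 ct]] := index2_two_cyclic sCG iC defC oC4 (s := s).
- by rewrite inE nCs.
- by rewrite os oC.
pose D := <[(x ^+ 2)%g]>%G.
have ox : #[x]%g = 2 * (2 ^ a.+2 * n) by rewrite mulnA -expnS -oC defC.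
have oD : #|D| = 2 ^ a.+2 * n.
  by rewrite -orderE orderXdiv ox ?mulKn ?dvdn_mulr.
have sDC : D \subset C by rewrite cycle_subG groupX // defC cycle_id.
have [Gt nCt] := setDP GCt.
have sTGC : (t *: D)%g \subset G :\: C.
  apply/subsetP=> y /lcosetP[d Dd ->]; have Cd := subsetP sDC d Dd.
  by rewrite inE groupMr // nCt groupM // (subsetP sCG).
have oT : #|(t *: D)%g| = 2 ^ a.+2 * n by rewrite card_lcoset.
have small y : y \in (t *: D)%g -> #[y.`_2]%g <= 2 ^ a.+2.
  case/lcosetP=> d Dd ->.
  (* The exponent is [#|D|], which kills [d], and is divisible by 4, which kills [t]. The
     divisibility rests on 16 dividing [#|G|]. *)
  have : ((t * d) ^+ (2 ^ a.+2 * n) = 1)%g.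
    rewrite expgMn; last exact: ct.
    have -> : (d ^+ (2 ^ a.+2 * n) = 1)%g by rewrite -oD expg_cardG.
    have -> : 2 ^ a.+2 * n = 4 * (2 ^ a * n) by rewrite !expnS; ring.
    by rewrite expgM t4 expg1n mulg1.
  move/eqP; rewrite -order_dvdn => dv.
  rewrite order_constt p_part leq_exp2l //.
  have := dvdn_leq_log 2 _ dv; rewrite muln_gt0 expn_gt0 n_gt0 => /(_ isT).
  by rewrite lognM ?expn_gt0 // pfactorK // (lognE 2 n) dvdn2 oddn andbF addn0.
rewrite (big_setID (t *: D)%g) /= (setIidPr sTGC).
have S1 : \sum_(g in (t *: D)%g) #[g.`_2]%g <= 16 * Q.
  rewrite (_ : 16 * Q = #|(t *: D)%g| * 2 ^ a.+2); last by rewrite /Q oT !expnS; ring.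
  by rewrite -sum_nat_const leq_sum.
have S2 : \sum_(g in G :\: C :\: (t *: D)%g) #[g.`_2]%g <= 32 * Q.
  have oR : #|G :\: C :\: (t *: D)%g| = 2 ^ a.+2 * n.
    by rewrite cardsD (setIidPr sTGC) oGC oT expnS -mulnA mulSn mul1n addnK.
  rewrite (_ : 32 * Q = #|G :\: C :\: (t *: D)%g| * 2 ^ a.+3).
    by rewrite -sum_nat_const leq_sum // => y /setDP[/setDP[Gy _] _]; apply: le_big.
  by rewrite /Q oR !expnS; ring.
by apply: leq_trans (leq_mul (leqnn 16) (leq_add S1 S2)) _; rewrite -mulnDl mulnA.
Qed.

(** * Bounds for [psi] and [psi''] *)

(** In units of [4 ^ a * psi N], [C] contributes 2/3 (plus [psi N / 3]). The rest contributes at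
    most 6/7 if [N] is not central, 1 if [N] is central and [a] is 1 or 2, and 3/4 if [N] is central
    and [a >= 3]. The totals 32/21 and 5/3 give the two alternatives; 17/12 is below 32/21. *)
Lemma psi_index2 (gT : finGroupType) (G C : {group gT}) (a n : nat) :
    odd n -> coprime n (totient n) -> #|G| = 2 ^ a.+1 * n -> ~~ cyclic G ->
    cyclic C -> C \subset G -> #|G : C|%g = 2 ->
  exists N : {group gT}, [/\ cyclic N, #|N| = n &
    21 * psi G <= psi N * (8 * 4 ^ a.+1 + 7) \/
    (a.+1 = 2 \/ a.+1 = 3) /\ 12 * psi G <= psi N * (5 * 4 ^ a.+1 + 4)].
Proof.
move=> oddn co_n oG ncycG cycC sCG iC.
have n_gt0 : 0 < n by case: (n) oddn.
have oC : #|C| = 2 ^ a * n.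
  apply/eqP; rewrite -(eqn_pmul2r (isT : 0 < 2)) -{1}iC Lagrange // oG expnS; apply/eqP; ring.
have co_an : coprime (2 ^ a) n by rewrite coprimeXl // coprime2n.
have [T [N [defC oT oN]]] := cyclic_coprime_dprod cycC oC co_an.
have [_ defTN _ _] := dprodP defC.
have sNC : N \subset C by rewrite -defTN mulG_subr.
have sTC : T \subset C by rewrite -defTN mulG_subl.
have cycN := cyclicS sNC cycC.
have leT := psi_cyclic_2group (cyclicS sTC cycC) oT.
have psiC : psi C = psi T * psi N by apply: (psi_dprod defC); rewrite oT oN.
have abC := cyclic_abelian cycC.
have oGC : #|G :\: C| = 2 ^ a * n.
  by rewrite cardsD (setIidPr sCG) oG oC expnS -mulnA mulSn mul1n addnK.
have psiG : psi G = psi C + \sum_(g in G :\: C) #[g]%g.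
  by rewrite /psi (big_setID C) /= (setIidPr sCG).
pose A := (N :&: 'C(G))%G.
have sAN : A \subset N by apply: subsetIl.
(* The 2'-part has odd order, so it lies in [C], and in [N] by its order. It commutes with [g],
   hence is central. *)
have partA g : g \in G :\: C -> g.`_(2^')%g \in A.
  move=> GCg; have [Gg nCg] := setDP GCg.
  have odd_g' : odd #[g.`_(2^')]%g.
    by rewrite order_constt; have := part_pnat 2^' #[g]%g; rewrite -odd_2'nat.
  have Cg' : g.`_(2^')%g \in C by rewrite (index2_odd sCG iC) ?groupX.
  rewrite inE (index2_cent sCG iC abC GCg) //; last first.
    by apply/commute_sym/commuteX.
  rewrite andbT -cycle_subG -(cardSg_cyclic cycC) ?cycle_subG // -orderE oN.
  have := order_dvdG Cg'; rewrite oC Gauss_dvdr //.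
  by rewrite coprime_sym coprimeXl // coprime2n.
have avg := sum_order_index2 sCG (subset_trans sAN sNC) (subsetIr _ _)
  (dvdn_odd (cardSg sAN) (_ : odd #|N|)) partA.
rewrite oN in avg; have {}avg := avg oddn.
exists N; split=> //.
have pow4 : 4 ^ a.+1 = 4 * (2 ^ a * 2 ^ a) by rewrite expnS expn4.
have pow4a : 4 ^ a = 2 ^ a * 2 ^ a by rewrite expn4.
have [cN | ncN] := boolP (N \subset 'C(G)%g).
  have eqA : A :=: N by apply/setIidPl.
  have {}avg : n * \sum_(g in G :\: C) #[g]%g = psi N * \sum_(g in G :\: C) #[g.`_2]%g.
    by rewrite -oN -{1}eqA avg /psi eqA.
  have sNG := subset_trans sNC sCG.
  have le_big g : g \in G -> #[g.`_2]%g <= 2 ^ a.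
    exact: (noncyclic_order2_bound cycN cN sNG oN oddn oG ncycG).
  have E1 : \sum_(g in G :\: C) #[g.`_2]%g <= 2 ^ a * n * 2 ^ a.
    by rewrite -oGC -sum_nat_const leq_sum // => g /setDP[Gg _]; apply: le_big.
  have S1 : \sum_(g in G :\: C) #[g]%g <= psi N * (2 ^ a * 2 ^ a).
    rewrite -(leq_pmul2l n_gt0) avg mulnCA leq_mul2l; apply/orP; right.
    by rewrite mulnCA mulnA.
  have [a_small | ] := boolP ((a == 1) || (a == 2)).
    right; split; first by case/orP: a_small => /eqP->; [left | right].
    move: leT S1; rewrite psiG psiC pow4 pow4a.
    move: (psi N) (psi T) (\sum_(g in _) _) (2 ^ a * 2 ^ a); clear => u v S q; nia.
  case: a oG oC co_an oT leT oGC le_big E1 S1 pow4 pow4a => [|[|[|a]]] //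
    oG oC co_an oT leT oGC le_big E1 S1 pow4 pow4a _.
    (* For [a = 0] all 2-parts are trivial, so an element outside [C] equals its 2'-part and lies in
       [N], a contradiction. *)
    have [g GCg] : exists g, g \in G :\: C by apply/card_gt0P; rewrite oGC mul1n.
    have [Gg nCg] := setDP GCg.
    case/negP: nCg; rewrite -(consttC 2 g).
    have -> : (g.`_2 = 1)%g.
      by apply/eqP; rewrite -order_eq1 eqn_leq le_big //= order_gt0.
    by rewrite mul1g; case/setIP: (partA g GCg) => /(subsetP sNC).
  left; have S2 := sum_order2_central cycC sCG iC ncycG oG oddn cycN oN cN sNC.
  have {}S2 : 16 * \sum_(g in G :\: C) #[g]%g <= psi N * (3 * 4 ^ a.+4).
    rewrite -(leq_pmul2l n_gt0) mulnCA avg mulnCA [leqRHS]mulnCA leq_mul2l.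
    by apply/orP; right; rewrite mulnCA [n * _]mulnC.
  move: leT S2; rewrite psiG psiC [4 ^ a.+4]expnS.
  move: (psi N) (psi T) (\sum_(g in _) _) (4 ^ a.+3); clear => u v S q; nia.
left; have [b def_n] : exists b, n = #|A| * b.
  by have /dvdnP[b] := cardSg sAN; rewrite oN mulnC => ->; exists b.
have coAb : coprime #|A| b.
  by apply: coprime_factors_coprime_totient; rewrite -def_n.
have [A' [B [defN oA' oB]]] := cyclic_coprime_dprod cycN (etrans oN def_n) coAb.
have [_ defAB _ _] := dprodP defN.
have sA'N : A' \subset N by rewrite -defAB mulG_subl.
have eqA : A' :=: A by apply/eqP; rewrite (eq_subG_cyclic cycN) // oA'.
have psiN : psi N = psi A * psi B.
  by rewrite (psi_dprod defN) ?oA' ?oB // /psi eqA.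
have b_gt1 : 1 < b.
  have : b != 1.
    apply: contraNneq ncN => b1; apply/setIidPl/eqP.
    by rewrite eqEcard sAN /= oN def_n b1 muln1.
  by case: (b) def_n n_gt0 => [|[|]] // ->; rewrite muln0.
have oddb : odd b by move: oddn; rewrite def_n oddM => /andP[].
have leB : 7 * b <= 3 * psi B by rewrite -oB psi_odd_lower_bound ?oB.
have E1 : \sum_(g in G :\: C) #[g.`_2]%g <= 2 ^ a * n * 2 ^ a.+1.
  rewrite -oGC -sum_nat_const leq_sum // => g /setDP[Gg _].
  rewrite dvdn_leq ?expn_gt0 //.
  have : #[g.`_2]%g %| #|G| by rewrite order_dvdG // groupX.
  by rewrite oG Gauss_dvdl // order_constt p_part coprimeXl // coprime2n.
have S1 : \sum_(g in G :\: C) #[g]%g <= psi A * (b * (2 * (2 ^ a * 2 ^ a))).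
  rewrite -(leq_pmul2l (cardG_gt0 A)) avg mulnCA leq_mul2l; apply/orP; right.
  by apply: leq_trans E1 _; rewrite {1}def_n expnS; apply: eq_leq; ring.
(* Here [7 * b <= 3 * psi B] turns [psi A * b] into at most 3/7 of [psi N = psi A * psi B]. *)
have {}S1 : 7 * \sum_(g in G :\: C) #[g]%g <= psi N * (6 * (2 ^ a * 2 ^ a)).
  rewrite psiN; set q := 2 ^ a * 2 ^ a in S1 *.
  apply: leq_trans (leq_mul (leqnn 7) S1) _.
  rewrite (_ : 7 * _ = 2 * psi A * q * (7 * b)); last by ring.
  rewrite (_ : psi A * psi B * _ = 2 * psi A * q * (3 * psi B)); last by ring.
  exact: leq_mul.
move: leT S1; rewrite psiG psiC pow4 pow4a.
move: (psi N) (psi T) (\sum_(g in _) _) (2 ^ a * 2 ^ a); clear => u v S q; nia.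
Qed.

(** If every cyclic subgroup had index at least 4, every order would be at most [#|G| / 4]. *)
Lemma cyclic_index_lt4 (gT : finGroupType) (G : {group gT}) :
  #|G| ^ 2 < 4 * psi G -> exists2 x, x \in G & #|G : <[x]>|%g < 4.
Proof.
move=> lt_psi; apply/exists_inP; apply: contraLR lt_psi.
rewrite negb_exists_in -leqNgt => /forall_inP big_index.
rewrite /psi big_distrr -mulnn -sum_nat_const /=; apply: leq_sum => x Gx.
have sxG : <[x]>%g \subset G by rewrite cycle_subG.
rewrite -(Lagrange sxG) mulnC leq_mul2l; apply/orP; right.
by have := big_index x Gx; rewrite -leqNgt.
Qed.

(** In index 3, the prime 3 divides [n]. As [n] is coprime to [totient n], 3 divides neither [n / 3]
    nor [totient n], so the passage from index 3 to index 2 applies. *)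
Lemma cyclic_index2 (gT : finGroupType) (G : {group gT}) (a n : nat) :
    odd n -> coprime n (totient n) -> #|G| = 2 ^ a.+1 * n -> ~~ cyclic G ->
    #|G| ^ 2 < 4 * psi G ->
  exists2 C : {group gT}, cyclic C & C \subset G /\ #|G : C|%g = 2.
Proof.
move=> oddn co_n oG ncycG /cyclic_index_lt4[x Gx].
have n_gt0 : 0 < n by case: (n) oddn.
have sCG : <[x]>%G \subset G by rewrite cycle_subG.
have := indexg_gt0 G <[x]>%G; case iC: #|G : _|%g => [|[|[|[|]]]] //= _ _.
- case/negP: ncycG; suffices -> : G :=: <[x]>%G by apply: cycle_cyclic.
  by apply/eqP; rewrite eqEsubset sCG -indexg_eq1 iC.
- by exists <[x]>%G => //; apply: cycle_cyclic.
have oG3 : 2 ^ a.+1 * n = 3 * #|<[x]>%g| by rewrite -oG -(Lagrange sCG) iC mulnC.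
have /dvdnP[m def_n] : 3 %| n.
  have : 3 %| 2 ^ a.+1 * n by rewrite oG3 dvdn_mulr.
  by rewrite Gauss_dvdr // coprimeXr.
have oC : #|<[x]>%g| = 2 ^ a.+1 * m.
  by apply/eqP; rewrite -(eqn_pmul2l (isT : 0 < 3)) -oG3 def_n mulnA mulnC.
have co3m : coprime m 3 by apply: coprime_factors_coprime_totient; rewrite -def_n.
have odd_m : odd m by move: oddn; rewrite def_n oddM => /andP[].
apply: (index3_index2 (cycle_cyclic x) sCG iC ncycG).
  by rewrite oC coprimeMr coprimeXr // coprime_sym.
rewrite oC totient_coprime ?coprimeXl ?coprime2n // totient_pfactor // mul1n.
rewrite coprimeMr coprimeXr //=.
apply: coprime_dvdr (totient_dvd n_gt0 (_ : m %| n)) (coprime_dvdl (_ : 3 %| n) co_n).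
  by rewrite def_n dvdn_mulr.
by rewrite def_n dvdn_mull.
Qed.

(** Inserting [psi N <= 2/3 * n ^ 2] gives the coefficients: 2/3 * 8/21 = 16/63, 2/3 * 5/12 = 5/18,
    and 2/3 * 1/3 = 2/9 for both remainders. *)
Lemma psi''_bound (gT : finGroupType) (G : {group gT}) (a n : nat) :
    odd n -> coprime n (totient n) -> 2 * totient n <= n ->
    #|G| = 2 ^ a.+1 * n -> ~~ cyclic G -> (1 / 4 < psi'' G)%R ->
  (psi'' G <= 16 / 63 + 2 / (9 * 4 ^+ a.+1))%R \/
  (a.+1 = 2 \/ a.+1 = 3) /\ (psi'' G <= 5 / 18 + 2 / (9 * 4 ^+ a.+1))%R.
Proof.
move=> oddn co_n le_phi oG ncycG lt_psi.
have n_gt0 : 0 < n by case: (n) oddn.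
have G_gt0 : (0 < #|G|%:R ^+ 2 :> rat)%R by rewrite exprn_gt0 // ltr0n.
have {}lt_psi : #|G| ^ 2 < 4 * psi G.
  move: lt_psi; rewrite /psi'' ltr_pdivlMr // mulrAC ltr_pdivrMr //.
  by rewrite mul1r [X in (_ < X)%R]mulrC -natrX -natrM ltr_nat.
have [C cycC [sCG iC]] := cyclic_index2 oddn co_n oG ncycG lt_psi.
have [N [cycN oN bound]] := psi_index2 oddn co_n oG ncycG cycC sCG iC.
have leN : 3 * psi N <= 2 * (n * n).
  have := psi_cyclic_totient cycN; rewrite oN => /(_ oddn co_n) le4.
  apply: leq_trans le4 _; rewrite -[4]/(2 * 2) -mulnA leq_mul2l /= mulnCA.
  by rewrite leq_mul2l le_phi orbT.
have psiE (c : rat) : ((psi G)%:R <= c * (4 ^+ a.+1 * n%:R ^+ 2) -> psi'' G <= c)%R.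
  move=> le_c; rewrite /psi'' ler_pdivrMr // oG natrM exprMn -natrX -expnM muln2 -addnn.
  by rewrite expnD -expn4 natrX.
have q_gt0 : (0 < 4 ^+ a.+1 :> rat)%R by rewrite exprn_gt0.
have Dq : (2 / (9 * 4 ^+ a.+1) * (4 ^+ a.+1 * n%:R ^+ 2) = 2 / 9 * n%:R ^+ 2 :> rat)%R.
  by field; exact: lt0r_neq0.
case: bound => [le21 | [a_small le12]]; [left | right; split; first exact: a_small];
  apply: psiE; rewrite mulrDl Dq.
  have : 63 * psi G <= 2 * (n * n) * (8 * 4 ^ a.+1 + 7).
    by apply: leq_trans (leq_mul leN (leqnn _)); lia.
  rewrite -(ler_nat rat) !(natrM, natrD, natrX).
  by move: (4 ^+ a.+1)%R n%:R%R (psi G)%:R%R => q m S; clear; lra.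
have : 36 * psi G <= 2 * (n * n) * (5 * 4 ^ a.+1 + 4).
  by apply: leq_trans (leq_mul leN (leqnn _)); lia.
rewrite -(ler_nat rat) !(natrM, natrD, natrX).
by move: (4 ^+ a.+1)%R n%:R%R (psi G)%:R%R => q m S; clear; lra.
Qed.

(** * Carmichael numbers and the thresholds of the four cases *)

(** For even [n], base -1 gives 1 congruent to -1, so [n] divides 2 and would be the prime 2. *)
Lemma carmichael_odd (n : nat) : carmichael n -> odd n.
Proof.
case=> /andP[n_gt1 not_pr] /(_ (- 1)%R); rewrite -signr_odd.
case odd_n: (odd n) => // /eqP; rewrite eqz_mod_dvd expr0 opprK => n_dv2.
have {}n_dv2 : n %| 2 by [].
have := dvdn_leq (isT : 0 < 2) n_dv2; rewrite leq_eqVlt ltnS leqNgt n_gt1 orbF => /eqP n2.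
by rewrite n2 in not_pr.
Qed.

End LehmerGroups.

Theorem theorem3p1 (n : nat) (hn : carmichael n)
  (hG :
    [\/ exists (gT : finGroupType) (G : {group gT}),
          [/\ ~~ cyclic G, #|G| = (2 * n)%N & (13 / 42 : rat) < psi'' G],
        exists (gT : finGroupType) (G : {group gT}),
          [/\ ~~ cyclic G, #|G| = (4 * n)%N & (7 / 24 : rat) < psi'' G],
        exists (gT : finGroupType) (G : {group gT}),
          [/\ ~~ cyclic G, #|G| = (8 * n)%N & (9 / 32 : rat) < psi'' G]
      | exists alpha : nat, (4 <= alpha)%N /\
        exists (gT : finGroupType) (G : {group gT}),
          [/\ ~~ cyclic G, #|G| = (2 ^ alpha * n)%N
            & (16 / 63 + 1 / (9 * 2 ^+ (2 * alpha - 1)) : rat) < psi'' G]]) :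
  ~ exists k : int, 2 <= k /\ k * (totient n)%:Z = n%:Z - 1.
Proof.
case=> k [k_ge2 def_n]; have odd_n := carmichael_odd hn.
have n_gt0 : (0 < n)%N by case: (n) odd_n.
have [m m_ge2 {}def_n] : exists2 m, (2 <= m)%N & (m * totient n = n.-1)%N.
  by case: k k_ge2 def_n => // m m_ge2 def_n; exists m => //; lia.
have le_phi : (2 * totient n <= n)%N.
  by apply: leq_trans (leq_pred n); rewrite -def_n leq_mul2r m_ge2 orbT.
(* The totient divides [n.-1], which is coprime to [n]. *)
have co_n : coprime n (totient n).
  apply: (@coprime_dvdr _ n.-1); first by rewrite -def_n dvdn_mull.
  by rewrite -{1}(prednK n_gt0) coprimeSn.
(* The thresholds exceed 1/4 and dominate every available bound: 16/63 + 2/36 = 13/42, 5/18 + 2/144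
   = 7/24 and 5/18 + 2/576 = 9/32. The 5/18 alternative occurs only for orders [4 * n] and
   [8 * n]. *)
case: hG => [] [].
- move=> gT [G [ncycG oG lt_psi]].
  have [||[[]//]] := @psi''_bound _ G 0 n odd_n co_n le_phi oG ncycG; lra.
- move=> gT [G [ncycG oG lt_psi]].
  have [||[_]] := @psi''_bound _ G 1 n odd_n co_n le_phi oG ncycG; lra.
- move=> gT [G [ncycG oG lt_psi]].
  have [||[_]] := @psi''_bound _ G 2 n odd_n co_n le_phi oG ncycG; lra.
case=> [[]//|a [a_ge4 [gT [G [ncycG oG lt_psi]]]]].
set r : rat := 2 ^+ (2 * a.+1 - 1) in lt_psi.
have pow4 : 4 ^+ a.+1 = 2 * r.
  rewrite /r -exprS (_ : (2 * a.+1 - 1).+1 = 2 * a.+1)%N; last by lia.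
  by rewrite exprM -[2 ^+ 2]natrX.
have r_gt0 : 0 < r by rewrite exprn_gt0.
have bound_eq : 2 / (9 * 4 ^+ a.+1) = 1 / (9 * r).
  by rewrite pow4; move: r r_gt0 {lt_psi pow4} => r r_gt0; field; exact: lt0r_neq0.
have pos : 0 < 1 / (9 * r) by apply: divr_gt0 ltr01 (mulr_gt0 _ r_gt0).
have [||[]] := @psi''_bound _ G a n odd_n co_n le_phi oG ncycG.
- by lra.
- by rewrite bound_eq; lra.
by case=> a_eq; rewrite a_eq in a_ge4.
Qed.
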